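(* Let $P$ be a transition kernel on the finite state space $S=\{1,\dots,n\}$ with action sets $A(s)$ and discount factor $\gamma\in(0,1)$, and suppose every transition probability $P(x\mid s,a)$ ($s,x\in S$, $a\in A(s)$) is strictly positive. Then, in a neighbourhood of $P$ (in the space of transition kernels), the equivalence class $[P]_{\mathrm{sa}}$ is a smooth embedded manifold of dimension $n(n-1)$. Its tangent space at $P$ is $$T_P[P]_{\mathrm{sa}}=\left\{\dot P:\ \dot P_{s,a}=\tfrac1\gamma e_s^{\mathsf T}H-P_{s,a}H\ \text{ for all } s\in S,\ a\in A(s),\ \text{ for some } H\in\mathbb R^{n\times n}\text{ with } H\mathbf 1=0\right\}.$$
   Context: $S=\{1,\dots,n\}$ is a finite set of states; each state $s$ has a finite nonempty action set $A(s)$; $\gamma\in(0,1)$ is fixed. A transition kernel $P$ assigns to each $s\in S$, $a\in A(s)$ a row vector $P_{s,a}=P(\cdot\mid s,a)\in\mathbb R^{1\times n}$ with nonnegative entries summing to $1$. The kernels lie in the affine space of families of row vectors $(P_{s,a})$ with $P_{s,a}\mathbf 1=1$, which has dimension $(n-1)\sum_{s\in S}|A(s)|$. $\mathbf 1$ is the all-ones column vector and $e_s$ the $s$th standard basis column vector. A state--action reward is a family of real numbers $r(s,a)$, $s\in S$, $a\in A(s)$. The optimal value $V_{P,r}^*\in\mathbb R^n$ is the unique vector with $V_{P,r}^*(s)=\max_{a\in A(s)}\{r(s,a)+\gamma P_{s,a}V_{P,r}^*\}$ for all $s$, and $\operatorname{Opt}_{P,r}(s)=\arg\max_{a\in A(s)}\{r(s,a)+\gamma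 P_{s,a}V_{P,r}^*\}$. Write $P\equiv_{\mathrm{sa}}Q$ if $\operatorname{Opt}_{P,r}(s)=\operatorname{Opt}_{Q,r}(s)$ for every state--action reward $r$ and every $s\in S$. $[P]_{\mathrm{sa}}$ is the set of all transition kernels $Q$ (same states, actions, discount factor) with $P\equiv_{\mathrm{sa}}Q$. *)

(* Defs.v *)
From HB Require Import structures.
From mathcomp Require Import all_boot all_order all_algebra.
From mathcomp Require Import all_classical all_reals.
From mathcomp Require Import topology normedtype derive.

Set Implicit Arguments.
Unset Strict Implicit.
Unset Printing Implicit Defensive.

Import Order.TTheory GRing.Theory Num.Theory.
Import numFieldNormedType.Exports.

Local Open Scope ring_scope.
Local Open Scope classical_set_scope.

Section Submanifold.
Context {R : realType}.

(* Meant for an open set U and a finite-dimensional V: there, continuity of all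
   the maps x |-> 'd f x v is continuity of x |-> 'd f x. *)
Fixpoint continuously_differentiable_on (k : nat) (V W : normedModType R)
    (U : set V) (f : V -> W) : Prop :=
  if k is k'.+1 then
    (forall x, U x -> differentiable f x) /\
    (forall v, continuously_differentiable_on k' U (fun x => 'd f x v))
  else forall x, U x -> {for x, continuous f}.

Definition smooth_on (V W : normedModType R) (U : set V) (f : V -> W) : Prop :=
  forall k, continuously_differentiable_on k U f.

(* Around each of its points, M is the image of an open set D of R^d under a
   smooth immersion f which is a homeomorphism from D onto M `&` U (with inverse
   g), where U is open in the finite-dimensional ambient space V. *)
Definition embedded_submanifold (V : normedModType R) (d : nat) (M : set V) :
    Prop :=
  forall p, M p ->
  exists (U : set V) (D : set 'rV[R]_d) (f : 'rV[R]_d -> V) (g : V -> 'rV[R]_d),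
  [/\ open U /\ U p,
      open D,
      smooth_on D f /\ (forall x, D x -> injective ('d f x)),
      f @` D = M `&` U &
      (forall x, D x -> g (f x) = x) /\ {within M `&` U, continuous g}].

(* Velocities at time 0 of the smooth curves of V that run inside M and are at p
   at time 0. *)
Definition tangent_space (V : normedModType R) (M : set V) (p : V) : set V :=
  [set v | exists (e : R) (c : R^o -> V),
    [/\ 0 < e,
        smooth_on [set t : R^o | `|t| < e] c,
        forall t : R, `|t| < e -> M (c t),
        c 0 = p &
        c^`() 0 = v]].

End Submanifold.

(* Families (P_{s,a}) of row vectors of R^n, stored as a matrix with one row for
   each state-action pair; the states are the elements of 'I_n. *)
Notation sa_family R n A := 'M[R]_(#|{: {s : _ & A s}}|, n).

Section MDP.
Context {R : realType} {n : nat} {A : 'I_n -> finType}.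
Implicit Types (P Q : sa_family R n A).
Implicit Types (r : forall s, A s -> R) (V : 'cV[R]_n) (gamma : R).

Definition sa_row P (s : 'I_n) (a : A s) : 'rV[R]_n :=
  row (enum_rank (Tagged (fun s => A s) a)) P.

Definition transition_kernel P : Prop :=
  forall s (a : A s),
    (forall x, 0 <= sa_row P a 0 x) /\ \sum_(x < n) sa_row P a 0 x = 1.

Definition action_value gamma P r V (s : 'I_n) (a : A s) : R :=
  r s a + gamma * (sa_row P a *m V) 0 0.

(* V s 0 is the maximum of the action values at s. *)
Definition bellman_equation gamma P r V : Prop :=
  forall s, (exists a : A s, V s 0 = action_value gamma P r V a) /\
            (forall a : A s, action_value gamma P r V a <= V s 0).

(* For a transition kernel P, nonempty action sets and 0 < gamma < 1, the Bellman
   equation has exactly one solution. *)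
Definition optimal_value gamma P r : 'cV[R]_n :=
  get [set V | bellman_equation gamma P r V].

Definition optimal_actions gamma P r (s : 'I_n) : set (A s) :=
  [set a | forall b : A s,
    action_value gamma P r (optimal_value gamma P r) b <=
    action_value gamma P r (optimal_value gamma P r) a].

Arguments optimal_actions gamma P r s : clear implicits.

Definition sa_equivalent gamma P Q : Prop :=
  forall r s, optimal_actions gamma P r s = optimal_actions gamma Q r s.

Definition sa_class gamma P : set (sa_family R n A) :=
  [set Q | transition_kernel Q /\ sa_equivalent gamma P Q].

End MDP.

(* Main.v *)
(** With [L := gamma^-1 E - P], where row [(s, a)] of [E] is [e_s], the rewards
    that make every action optimal form the column space of [gamma L].  An
    equivalent kernel [Q] therefore satisfies [gamma^-1 E - Q = L M] for a square
    matrix [M], that is [Q = P + L H] with [H = 1 - M], and row sums together with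
    the injectivity of [L] force [H 1 = 0].  Conversely, if [Q = P + L H] then a
    value vector [V] for [Q] and the value vector [V - H V] for [P] have the same
    advantages, so [Q] is equivalent to [P].  Near [P], where positivity is
    automatic, the class is thus an open piece of the affine space
    [P + { L H | H 1 = 0 }], and [L] is injective. *)

Require Import Defs.
From HB Require Import structures.
From mathcomp Require Import all_boot all_order all_algebra.
From mathcomp Require Import all_classical all_reals interval_inference.
From mathcomp Require Import topology normedtype derive sequences.

Set Implicit Arguments.
Unset Strict Implicit.
Unset Printing Implicit Defensive.

Import Order.TTheory GRing.Theory Num.Theory.
Import numFieldNormedType.Exports.

Local Open Scope ring_scope.
Local Open Scope classical_set_scope.

(** * Affine maps, affine pieces as submanifolds, and tangent vectors *)

Section LinearMaps.
Context {R : realType}.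

(** Expanding [X] in elementary matrices turns [f] into a finite sum of coordinate functions times
    fixed vectors. *)
Lemma mx_linear_continuous (m n : nat) (W : normedModType R)
  (f : {linear 'M[R]_(m, n) -> W}) : continuous f.
Proof.
have -> : f = \sum_(i < m) \sum_(j < n)
    (fun X : 'M[R]_(m, n) => X i j *: f (delta_mx i j)) :> (_ -> _).
  apply/funext => X; rewrite fct_sumE {1}[X]matrix_sum_delta linear_sum.
  apply: eq_bigr => i _; rewrite fct_sumE linear_sum.
  by apply: eq_bigr => j _; rewrite linearZ.
move=> X; apply: differentiable_continuous.
apply: differentiable_sum => i; apply: differentiable_sum => j.
exact/differentiableZl/differentiable_coord.
Qed.

Lemma smooth_on_cst (V W : normedModType R) (U : set V) (c : W) :
  smooth_on U (fun=> c).
Proof.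
move=> k; elim: k c => [|k IH] c /=; first by move=> x _; exact: cst_continuous.
split=> [x _|v]; first exact: differentiable_cst.
suff -> : (fun x => 'd (fun=> c) x v) = (fun=> 0 : W) by exact: IH.
by apply/funext => x; rewrite (diff_cst c).
Qed.

Section Affine.
Variables (V W : normedModType R) (f : {linear V -> W}) (p : W).
Hypothesis f_cont : continuous f.

Lemma is_diff_affine x : is_diff x (fun y => p + f y) f.
Proof.
apply: (@is_diff_eq _ _ _ _ (0 + (f : V -> W))); last by rewrite add0r.
apply: is_diffD; apply: DiffDef (linear_differentiable _ _) (diff_lin _ _);
  exact: f_cont.
Qed.

Lemma diff_affine x : 'd (fun y => p + f y) x = f :> (V -> W).
Proof. by have [_ ->] := is_diff_affine x. Qed.

Lemma smooth_on_affine U : smooth_on U (fun y => p + f y).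
Proof.
case=> [|k] /=.
  by move=> x _; apply: differentiable_continuous; have [] := is_diff_affine x.
split=> [x _|v]; first by have [] := is_diff_affine x.
suff -> : (fun x => 'd (fun y => p + f y) x v) = (fun=> f v).
  exact: smooth_on_cst.
by apply/funext => x; rewrite diff_affine.
Qed.

Lemma affine_continuous : continuous (fun y => p + f y).
Proof. by move=> x; exact: (@smooth_on_affine setT 0%N x I). Qed.

End Affine.

(** A single chart serves all points: the affine parametrization restricted to the preimage of [U].
    The left inverse [g] gives both injectivity of the differential and the continuous inverse of
    the chart. *)
Lemma embedded_submanifold_affine (V : normedModType R) (d : nat)
    (M U : set V) (p : V) (f : {linear 'rV[R]_d -> V})
    (g : {linear V -> 'rV[R]_d}) :
  open U -> continuous g -> cancel f g ->
  (forall q, U q -> M q <-> exists x, q = p + f x) ->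
  embedded_submanifold d (M `&` U).
Proof.
move=> oU cg fK MU q [Mq Uq].
have cf : continuous f by exact: mx_linear_continuous.
exists U, ((fun x => p + f x) @^-1` U), (fun x => p + f x),
  (fun y => - g p + g y); split.
- by split.
- by apply: open_comp => // x _; exact: affine_continuous.
- split=> [|x _]; first exact: smooth_on_affine.
  by rewrite diff_affine //; exact: can_inj fK.
- apply/seteqP; split=> [_ [x Ux <-]|y [[My Uy] _]].
    by split=> //; split=> //; apply/MU => //; exists x.
  have [x yE] := (MU y Uy).1 My.
  by exists x => //=; rewrite -yE.
- split=> [x _|]; first by rewrite linearD addKr fK.
  exact/continuous_subspaceT/affine_continuous.
Qed.

(** Along a curve [c] inside [M], [h \o c] is constant near 0, so its derivative, [h] of the
    velocity, vanishes. *)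
Lemma tangent_space_sub (V W : normedModType R) (M : set V) (p : V)
    (h : {linear V -> W}) :
  continuous h -> (forall q, M q -> h q = h p) ->
  tangent_space M p `<=` [set v | h v = 0].
Proof.
move=> ch hM v [e [c [e0 sc Mc c0 cv]]] /=.
have [dc _] := sc 1%N.
have dc0 : differentiable c (0 : R^o) by apply: dc; rewrite /= normr0.
have dh := @linear_differentiable _ _ _ h (c 0) ch.
have dhc := differentiable_comp dc0 dh.
have <- : 'D_(1 : R^o) (h \o c) (0 : R^o) = h v.
  rewrite deriveE // diff_comp //= (diff_lin _ ch).
  by rewrite -cv derive1E deriveE.
rewrite -(derive_cst (V := R^o) (h p) (0 : R^o) 1).
apply: near_eq_derive; exists e => //= t te; apply: hM; apply: Mc.
by move: te; rewrite /= sub0r normrN.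
Qed.

(** The curve is the straight line itself, cut off at times so short that it stays in the open set
    [U]. *)
Lemma tangent_space_line (V : normedModType R) (M U : set V) (p v : V) :
  open U -> U p -> (forall t : R, U (p + t *: v) -> M (p + t *: v)) ->
  tangent_space M p v.
Proof.
move=> oU Up UM.
pose l := GRing.scale^~ v : R^o -> V.
have sl : linear l by move=> a b b'; rewrite /l scalerDl scalerA.
pose lM := GRing.isLinear.Build _ _ _ _ l sl.
pose L : {linear R^o -> V} := HB.pack l lM.
have cL : continuous L by exact: scalel_continuous.
have [e /= e0 eU] : \forall t \near (0 : R^o), U (p + L t).
  have : nbhs (p + L 0) U.
    by apply: open_nbhs_nbhs; split=> //; rewrite linear0 addr0.
  exact: (@affine_continuous _ _ L p cL 0 U).
exists e, (fun t => p + L t); split=> //.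
- exact: smooth_on_affine.
- by move=> t te; apply: UM; apply: eU; rewrite /= sub0r normrN.
- by rewrite linear0 addr0.
- rewrite derive1E deriveE; last by have [] := is_diff_affine p cL 0.
  by rewrite diff_affine //= /l scale1r.
Qed.

End LinearMaps.

(** * The Bellman equation: existence and uniqueness of the optimal value *)

Section Bellman.
Context {R : realType} {n : nat} {A : 'I_n -> finType}.
Variables (gamma : R).
Hypotheses (A_gt0 : forall s, (0 < #|A s|)%N) (gamma01 : 0 < gamma < 1).
Let gamma_ge0 : 0 <= gamma. Proof. by case/andP: gamma01 => /ltW. Qed.
Let gamma_neq0 : gamma != 0. Proof. by case/andP: gamma01 => /lt0r_neq0. Qed.
Implicit Types (P Q : sa_family R n A) (V W : 'cV[R]_n).
Implicit Types (r : forall s, A s -> R).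

Lemma action_exists s : exists a : A s, true.
Proof. by have /card_gt0P[a _] := A_gt0 s; exists a. Qed.

Lemma ler_mx_normr m p (X : 'M[R]_(m, p)) i j : `|X i j| <= `|X|.
Proof.
by rewrite [leRHS]/Num.Def.normr /= mx_normrE (le_bigmax _ _ (i, j)).
Qed.

Lemma cV_normrB_le V W (e : R) : 0 <= e ->
  (forall s, V s 0 - W s 0 <= e) -> (forall s, W s 0 - V s 0 <= e) ->
  `|V - W| <= e.
Proof.
move=> e0 VWe WVe; rewrite [leLHS]/Num.Def.normr /= mx_normrE.
apply/bigmax_leP; split=> //= -[s j] _ /=.
by rewrite ord1 !mxE ler_norml VWe andbT lerNl opprB WVe.
Qed.

Lemma sa_row_mul_le P V s (a : A s) : transition_kernel P ->
  (sa_row P a *m V) 0 0 <= `|V|.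
Proof.
move=> /(_ s a)[P0 P1]; rewrite mxE -[leRHS]mul1r -P1 mulr_suml.
apply: ler_sum => x _; apply: ler_wpM2l => //.
exact: le_trans (ler_norm _) (ler_mx_normr _ _ _).
Qed.

Lemma action_value_lipschitz P r V W s (a : A s) : transition_kernel P ->
  action_value gamma P r V a - action_value gamma P r W a <= gamma * `|V - W|.
Proof.
move=> kP; rewrite /action_value opprD addrACA subrr add0r -mulrBr.
have -> : (sa_row P a *m V) 0 0 - (sa_row P a *m W) 0 0 =
    (sa_row P a *m (V - W)) 0 0 by rewrite mulmxBr !mxE.
by rewrite ler_wpM2l // sa_row_mul_le.
Qed.

(** The Bellman operator [T] contracts the sup norm by the factor [gamma], so Banach's theorem gives
    a fixed point. *)
Lemma bellman_equation_exists P r : transition_kernel P ->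
  exists V, bellman_equation gamma P r V.
Proof.
move=> kP; pose a0 s := xchoose (action_exists s).
pose best V s := [arg max_(a > a0 s) action_value gamma P r V a]%O.
have bestP V s (b : A s) :
    action_value gamma P r V b <= action_value gamma P r V (best V s).
  by rewrite /best; case: arg_maxP => // a _; exact.
pose T V : 'cV[R]_n := \col_s action_value gamma P r V (best V s).
have T_contract V W : `|T V - T W| <= gamma * `|V - W|.
  have T_le V' W' s : T V' s 0 - T W' s 0 <= gamma * `|V' - W'|.
    rewrite !mxE.
    (* Playing the greedy action of [V'] against [W'] can only lower the subtracted maximum, so one
       common action remains to be compared. *)
    apply: le_trans (action_value_lipschitz r V' W' (best V' s) kP).
    by rewrite lerD2l lerN2.
  apply: cV_normrB_le => [|s|s]; first by rewrite mulr_ge0.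
    exact: T_le.
  by rewrite distrC T_le.
pose X : completeNormedModType R :=
  HB.pack 'cV[R]_n (Uniform_isComplete.Build 'cV[R]_n (@cauchy_cvg _)).
have [V _ VT] : exists2 V : X, setT V & V = T V.
  pose f : {fun [set: X] >-> [set: X]} :=
    HB.pack T (isFun.Build _ _ setT setT T (fun _ _ => I)).
  apply: (@banach_fixed_point R X setT f); last 2 first.
  - exact: closedT.
  - by exists 0.
  exists (NngNum gamma_ge0); split=> /=; first by case/andP: gamma01.
  by move=> [V W] _ /=; exact: T_contract.
exists V => s; rewrite VT mxE -VT; split; first by exists (best V s).
exact: bestP.
Qed.

Lemma bellman_equation_unique P r V W : transition_kernel P ->
  bellman_equation gamma P r V -> bellman_equation gamma P r W -> V = W.
Proof.
move=> kP BV BW.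
have le_VW V' W' : bellman_equation gamma P r V' ->
    bellman_equation gamma P r W' ->
    forall s, V' s 0 - W' s 0 <= gamma * `|V' - W'|.
  move=> BV' BW' s; have [[a ->] _] := BV' s; have [_ /(_ a) Wa] := BW' s.
  apply: le_trans (action_value_lipschitz r V' W' a kP).
  by rewrite lerD2l lerN2.
have VW : `|V - W| <= gamma * `|V - W|.
  apply: cV_normrB_le => [|s|s]; first by rewrite mulr_ge0.
    exact: le_VW.
  by rewrite distrC le_VW.
apply/eqP; rewrite -subr_eq0 -normr_eq0 eq_le normr_ge0 andbT leNgt.
apply/negP => VW0; move: VW; rewrite leNgt gtr_pMl //.
by case/andP: gamma01 => _ ->.
Qed.

Lemma optimal_valueP P r : transition_kernel P ->
  bellman_equation gamma P r (optimal_value gamma P r).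
Proof.
move=> kP; have [V BV] := bellman_equation_exists r kP.
exact: (@getPex _ [set V | bellman_equation gamma P r V]) (ex_intro _ V BV).
Qed.

Lemma optimal_value_eq P r V : transition_kernel P ->
  bellman_equation gamma P r V -> optimal_value gamma P r = V.
Proof. by move=> kP; exact/bellman_equation_unique/optimal_valueP. Qed.


(** * The matrix [bellman_mx] and the linear description of equivalence *)

Definition sa_index s (a : A s) : 'I_(#|{: {s : _ & A s}}|) :=
  enum_rank (Tagged (fun s => A s) a).

Lemma sa_index_all (T : 'I_(#|{: {s : _ & A s}}|) -> Prop) :
  (forall s (a : A s), T (sa_index a)) -> forall i, T i.
Proof.
by move=> TA i; rewrite -(enum_valK i); case: (enum_val i) => s a; exact: TA.
Qed.

Definition bellman_mx P : sa_family R n A :=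
  gamma^-1 *: (\matrix_(i, j) (tag (enum_val i) == j)%:R) - P.

Lemma row_bellman_mx_mul P k (H : 'M[R]_(n, k)) s (a : A s) :
  row (sa_index a) (bellman_mx P *m H) =
    gamma^-1 *: (delta_mx 0 s *m H) - sa_row P a *m H.
Proof.
rewrite row_mul scalemxAl -mulmxBl; congr (_ *m H); apply/rowP => x.
by rewrite !mxE enum_rankK /= [s == x]eq_sym.
Qed.

(** Advantages depend on [V] only through [bellman_mx P *m V]; this turns questions of optimality
    into linear algebra. *)
Lemma action_value_bellman_mx P r V s (a : A s) :
  action_value gamma P r V a - V s 0 =
    r s a - gamma * (bellman_mx P *m V) (sa_index a) 0.
Proof.
have := congr1 (fun X : 'rV_1 => X 0 0) (row_bellman_mx_mul P V a).
rewrite mxE => ->; rewrite -rowE !mxE mulrBr mulrA divff // mul1r.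
by rewrite /action_value mxE opprB addrA.
Qed.

(** The right-hand side is the same for all kernels, which is what later forces [H 1 = 0]. *)
Lemma bellman_mx_mul1 P : transition_kernel P ->
  bellman_mx P *m const_mx 1 = const_mx (gamma^-1 - 1) :> 'cV_ _.
Proof.
move=> kP; apply/row_matrixP; elim/sa_index_all => s a.
rewrite row_bellman_mx_mul -rowE; apply/rowP => x; rewrite !mxE mulr1.
congr (_ - _); rewrite -[RHS](kP s a).2.
by apply: eq_bigr => y _; rewrite !mxE mulr1.
Qed.

(** Under the zero reward all advantages of [V] vanish, so [V] and 0 both solve the Bellman equation
    and uniqueness applies. *)
Lemma bellman_mx_inj P V :
  transition_kernel P -> bellman_mx P *m V = 0 -> V = 0.
Proof.
move=> kP PV0; apply: (bellman_equation_unique (r := fun _ _ => 0) kP).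
  have E s (a : A s) : action_value gamma P (fun _ _ => 0) V a = V s 0.
    by apply/eqP; rewrite -subr_eq0 action_value_bellman_mx PV0 mxE mulr0 subrr.
  move=> s; have [a _] := action_exists s.
  by split=> [|b]; [exists a|]; rewrite E.
have E s (a : A s) : action_value gamma P (fun _ _ => 0) 0 a = 0.
  by rewrite /action_value mulmx0 mxE mulr0 addr0.
move=> s; have [a _] := action_exists s.
by split=> [|b]; [exists a|]; rewrite E mxE.
Qed.

(** The reward [gamma * (bellman_mx P *m V)] makes every action optimal under [P], hence under [Q].
    All advantages under [Q] are then zero, and the optimal value of [Q] is the required [W]. *)
Lemma sa_equivalent_factor P Q : transition_kernel P -> transition_kernel Q ->
  sa_equivalent gamma P Q ->
  exists M : 'M[R]_n, bellman_mx P = bellman_mx Q *m M.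
Proof.
move=> kP kQ PQ.
have factor V : exists W, bellman_mx P *m V = bellman_mx Q *m W.
  pose r s (a : A s) := gamma * (bellman_mx P *m V) (sa_index a) 0.
  have Pr s (a : A s) : action_value gamma P r V a = V s 0.
    by apply/eqP; rewrite -subr_eq0 action_value_bellman_mx subrr.
  have VP : optimal_value gamma P r = V.
    apply: optimal_value_eq => // s; have [a _] := action_exists s.
    by split=> [|b]; [exists a|]; rewrite Pr.
  exists (optimal_value gamma Q r); apply/colP; elim/sa_index_all => s a.
  have QT (b : A s) : @optimal_actions R n A gamma Q r s b.
    by rewrite -PQ => c; rewrite VP !Pr.
  have [[b bE] bmax] := optimal_valueP r kQ s.
  have QV : action_value gamma Q r (optimal_value gamma Q r) a =
      optimal_value gamma Q r s 0.
    by apply/eqP; rewrite eq_le bmax {1}bE; exact: QT.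
  move/eqP: QV; rewrite -subr_eq0 action_value_bellman_mx subr_eq0 => /eqP.
  exact: (mulfI gamma_neq0).
(* The vectors found for the standard basis become the columns of the factor. *)
have /choice[W WE] j := factor (delta_mx j 0).
exists (\matrix_(i, j) W j i 0); apply/matrixP => i j.
transitivity ((bellman_mx P *m delta_mx j 0 : 'cV_ _) i 0).
  by rewrite -colE [RHS]mxE.
rewrite WE [LHS]mxE [RHS]mxE.
by apply: eq_bigr => k _; congr (_ * _); rewrite mxE.
Qed.

Lemma sa_equivalentP P Q : transition_kernel P -> transition_kernel Q ->
  sa_equivalent gamma P Q <->
  exists2 H : 'M[R]_n, H *m const_mx 1 = 0 :> 'cV[R]_n &
    Q = P + bellman_mx P *m H.
Proof.
move=> kP kQ; split=> [PQ|[H _ QE] r s].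
  (* The factorization is used with the kernels exchanged, so that [bellman_mx P] stands on the left
     of [M] and can be cancelled. *)
  have QP : sa_equivalent gamma Q P by move=> r s; rewrite PQ.
  have [M QM] := sa_equivalent_factor kQ kP QP.
  exists (1%:M - M).
    apply: (bellman_mx_inj kP).
    by rewrite mulmxA mulmxBr mulmx1 -QM mulmxBl !bellman_mx_mul1 // subrr.
  rewrite mulmxBr mulmx1 -QM /bellman_mx opprB addrA [P + _]addrC subrK.
  by rewrite addrC subrK.
pose V := optimal_value gamma Q r.
have QPH : bellman_mx Q *m V = bellman_mx P *m (V - H *m V).
  by rewrite mulmxBr mulmxA -mulmxBl QE /bellman_mx opprD addrA.
(* At each state the two kernels have the same advantages, so their action values differ by a
   constant there. *)
have adv t (a : A t) : action_value gamma P r (V - H *m V) a =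
    action_value gamma Q r V a - V t 0 + (V - H *m V) t 0.
  by rewrite action_value_bellman_mx QPH -action_value_bellman_mx subrK.
have VP : optimal_value gamma P r = V - H *m V.
  apply: optimal_value_eq => // t; have [[a aE] amax] := optimal_valueP r kQ t.
  split=> [|b]; first by exists a; rewrite adv -aE subrr add0r.
  by rewrite adv gerDr subr_le0; exact: amax.
by apply/seteqP; split=> a aopt b; move: (aopt b); rewrite VP !adv !lerD2r.
Qed.

(** Injectivity on column vectors is row freeness of the transpose. The left inverse later supplies
    the inverse chart. *)
Lemma bellman_mx_linv P :
  transition_kernel P -> exists B, B *m bellman_mx P = 1%:M.
Proof.
move=> kP; have /row_freeP[B PB] : row_free (bellman_mx P)^T.
  apply: inj_row_free => v vP.
  rewrite -[v]trmxK (bellman_mx_inj (V := v^T) kP) ?trmx0 //.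
  by apply: trmx_inj; rewrite trmx_mul trmxK vP trmx0.
by exists B^T; apply: trmx_inj; rewrite trmx_mul trmxK PB trmx1.
Qed.

Lemma transition_kernel_pos Q : (forall i j, 0 < Q i j) ->
  Q *m const_mx 1 = const_mx 1 :> 'cV_ _ -> transition_kernel Q.
Proof.
move=> Q0 Q1 s a; split=> [x|]; first by rewrite mxE ltW.
have := congr1 (fun X : 'cV_ _ => X (sa_index a) 0) Q1; rewrite !mxE => <-.
by apply: eq_bigr => x _; rewrite !mxE mulr1.
Qed.

Lemma transition_kernel_mul1 P : transition_kernel P ->
  P *m const_mx 1 = const_mx 1 :> 'cV_ _.
Proof.
move=> kP; apply/colP; elim/sa_index_all => s a; rewrite !mxE -[RHS](kP s a).2.
by apply: eq_bigr => x _; rewrite !mxE mulr1.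
Qed.

(** For positive [Q] the kernel condition comes for free: [H 1 = 0] preserves the row sums of
    [P]. *)
Lemma sa_class_pos P Q : transition_kernel P -> (forall i j, 0 < Q i j) ->
  sa_class gamma P Q <->
  exists2 H : 'M[R]_n, H *m const_mx 1 = 0 :> 'cV[R]_n &
    Q = P + bellman_mx P *m H.
Proof.
move=> kP Q0; split=> [[kQ PQ]|PQ]; first exact/sa_equivalentP.
suff kQ : transition_kernel Q by split=> //; apply/sa_equivalentP.
case: PQ => H H1 QE; apply: transition_kernel_pos => //.
by rewrite QE mulmxDl -mulmxA H1 mulmx0 addr0 transition_kernel_mul1.
Qed.

End Bellman.

(** * Positivity is open; a basis of the zero-sum row vectors; the theorem *)

Lemma mx_pos_open (R : realType) (m n : nat) :
  open [set X : 'M[R]_(m, n) | forall i j, 0 < X i j].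
Proof.
rewrite openE => X X0.
have pos (i : 'I_m) (j : 'I_n) : nbhs X [set Y : 'M[R]_(m, n) | 0 < Y i j].
  exact: (@coord_continuous R m n i j X _ (lt_nbhsr (X0 i j))).
have pos_row i := filter_forall (nbhs_filter X) (pos i).
exact: (filter_forall (nbhs_filter X) pos_row).
Qed.

(** The rows of [N] form a basis of the zero-sum vectors. Writing [H = X *m N] with [n - 1] columns
    in [X] accounts for the dimension [n * (n - 1)]. *)
Lemma mul1_kernel_basis (F : fieldType) (n : nat) :
  exists2 N : 'M[F]_(n - 1, n), row_free N &
    forall k (H : 'M[F]_(k, n)),
      H *m const_mx 1 = 0 :> 'cV[F]_k <-> exists X, H = X *m N.
Proof.
pose K := kermx (const_mx 1 : 'cV[F]_n).
have rK : \rank K = (n - 1)%N.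
  (* For [n = 0] truncated subtraction makes both sides 0; otherwise the all-ones column has rank
     1. *)
  rewrite mxrank_ker; case: n @K => [|n] K; first by rewrite sub0n.
  rewrite (_ : \rank _ = 1%N) //; apply/eqP.
  rewrite eqn_leq rank_leq_col lt0n mxrank_eq0.
  by apply/eqP => /matrixP/(_ 0 0); rewrite !mxE => /eqP; rewrite oner_eq0.
have KH k (H : 'M[F]_(k, n)) :
    H *m const_mx 1 = 0 :> 'cV[F]_k <-> exists X, H = X *m row_base K.
  split=> [H1|[X ->]].
    by apply/submxP; rewrite eq_row_base; apply/sub_kermxP.
  by apply/sub_kermxP; rewrite (submx_trans (submxMl _ _)) // eq_row_base.
have := row_base_free K; move: (row_base K) KH; rewrite rK => N KN fN.
by exists N.
Qed.

Theorem proposition3p6 (R : realType) (n : nat) (A : 'I_n -> finType)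
    (gamma : R) (P : sa_family R n A) :
  (forall s, (0 < #|A s|)%N) ->
  0 < gamma < 1 ->
  transition_kernel P ->
  (forall s (a : A s) x, 0 < sa_row P a 0 x) ->
  (exists U : set (sa_family R n A),
     [/\ open U, U P &
         embedded_submanifold (n * (n - 1))%N (sa_class gamma P `&` U)]) /\
  tangent_space (sa_class gamma P) P =
    [set Pdot : sa_family R n A |
      exists2 H : 'M[R]_n, H *m const_mx 1 = 0 :> 'cV[R]_n &
        forall s (a : A s),
          sa_row Pdot a =
            gamma^-1 *: (delta_mx 0 s *m H) - sa_row P a *m H].
Proof.
move=> A_gt0 gamma01 kP Ppos.
pose U := [set Q : sa_family R n A | forall i j, 0 < Q i j].
have oU : open U by exact: mx_pos_open.
have UP : U P.
  by apply: sa_index_all => s a x; have := Ppos s a x; rewrite mxE.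
pose L := bellman_mx gamma P.
have [B BL] := bellman_mx_linv A_gt0 gamma01 kP; rewrite -/L in BL.
have [N /row_freeP[C NC] NP] := mul1_kernel_basis R n.
have classP Q : U Q ->
    sa_class gamma P Q <-> exists X : 'M_(n, n - 1), Q = P + L *m (X *m N).
  move=> UQ; rewrite (sa_class_pos A_gt0 gamma01 kP UQ).
  split=> [[H /NP[X ->] ->]|[X ->]]; first by exists X.
  by exists (X *m N) => //; apply/NP; exists X.
split.
  exists U; split=> //.
  (* The parameters are the entries of [X], sent to [L *m (X *m N)]; [g] undoes this with the left
     inverse [B] of [L] and the right inverse [C] of [N]. *)
  pose f : {linear 'rV[R]_(n * (n - 1)) -> sa_family R n A} :=
    (mulmx L \o mulmxr N \o vec_mx)%FUN.
  pose g : {linear sa_family R n A -> 'rV[R]_(n * (n - 1))} :=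
    (mxvec \o mulmxr C \o mulmx B)%FUN.
  apply: (embedded_submanifold_affine (f := f) (g := g) (p := P)) => //.
  - exact: mx_linear_continuous.
  - by move=> x; rewrite /f /g /= !mulmxA BL mul1mx -mulmxA NC mulmx1 vec_mxK.
  - move=> Q /classP ->; split=> [[X ->]|[x ->]]; last by exists (vec_mx x).
    by exists (mxvec X); rewrite /f /= mxvecK.
(* [h] is the identity minus a projection onto the matrices [L *m (X *m N)]. It is constant on the
   whole class, not just on [U], since tangent curves may run anywhere in the class. *)
pose h : {linear sa_family R n A -> sa_family R n A} :=
  (idfun \- (mulmx L \o mulmxr N \o mulmxr C \o mulmx B))%FUN.
have hE X : h (L *m (X *m N)) = 0.
  by rewrite /h /= (mulmxA B) BL mul1mx -(mulmxA X) NC mulmx1 subrr.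
apply/seteqP; split=> [v Tv|v [H H1 vH]].
  have hM Q : sa_class gamma P Q -> h Q = h P.
    move=> [kQ /(sa_equivalentP A_gt0 gamma01 kP kQ)[H /NP[X ->] ->]].
    by rewrite linearD hE addr0.
  have := tangent_space_sub (h := h) (@mx_linear_continuous _ _ _ _ h) hM Tv.
  move=> /= /eqP; rewrite subr_eq0 => /eqP vE.
  (* [h v = 0] says that [v] equals its projection, from which [H] is read off. *)
  exists (B *m v *m C *m N); first by apply/NP; exists (B *m v *m C).
  by move=> s a; rewrite -row_bellman_mx_mul /sa_row -vE.
have vE : v = L *m H.
  apply/row_matrixP; apply: sa_index_all => s a.
  by rewrite row_bellman_mx_mul -vH.
(* While [P + t *: v] stays positive it lies in the class, with [t *: H] as its matrix. *)
apply: (tangent_space_line oU UP) => t Ut; apply/sa_class_pos => //.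
exists (t *: H); first by rewrite -scalemxAl H1 scaler0.
by rewrite vE scalemxAr.
Qed.
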